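(* Let $L$ be a selfadjoint operator on the complex Hilbert space $\mathcal{H}$ with $L\ge 0$. Let $f,g\in\mathcal{H}$ with $f,g\in D(L^n)$ for all natural numbers $n$ be given. The following statements hold: (a) If $d_L(f,g)<\infty$, then $$\lim_{t\to 0+}\frac{\log|\langle f,e^{-tL}g\rangle|}{\log t}=d_L(f,g)=\lim_{t\to 0+}\frac{\log|\langle f,e^{-itL}g\rangle|}{\log t}.$$ (b) If $d_L(f,g)=\infty$, then for any natural number $n$ there exists a constant $C_n(f,g)>0$ such that $$|\langle f,e^{-tL}g\rangle|\le C_n(f,g)\cdot t^{n+1}\quad\text{and}\quad |\langle f,e^{-itL}g\rangle|\le C_n(f,g)\cdot t^{n+1}$$ for all $t\ge 0$.
   Context: $D(A)$ denotes the domain of an operator $A$; $L^n$, $e^{-tL}$ and $e^{-itL}$ are defined by the spectral calculus, with $L^0$ the identity. Natural numbers include $0$. For $f,g\in\mathcal{H}$ with $f,g\in D(L^n)$ for all natural numbers $n$, $$d_L(f,g):=\inf\{n : \langle f,L^ng\rangle\ne 0\},$$ where $n$ ranges over the natural numbers and the infimum over the empty set is $\infty$. *)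

(* Defs.v *)
From HB Require Import structures.
From mathcomp Require Import all_boot all_order all_algebra.
From mathcomp Require Import sesquilinear complex.
From mathcomp Require Import all_classical all_reals all_analysis.

Set Implicit Arguments.
Unset Strict Implicit.
Unset Printing Implicit Defensive.
Import Order.TTheory GRing.Theory Num.Theory Num.Def.
Import numFieldTopology.Exports numFieldNormedType.Exports.
Local Open Scope classical_set_scope.
Local Open Scope ring_scope.
Local Open Scope complex_scope.

(* The inner product is linear in its first argument and conjugate-linear in
   the second one, as [{dot _ for conjC}] has it. *)
HB.mixin Record Complete_isHilbert (R : realType) H
    of CompleteNormedModule R[i] H := {
  inner : {dot H for conjC} ;
  sqr_norm_inner : forall x : H, `|x| ^+ 2 = inner x x }.

#[short(type="hilbertType")]
HB.structure Definition Hilbert (R : realType) :=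
  { H of Complete_isHilbert R H & CompleteNormedModule R[i] H }.

(* A possibly unbounded operator: the values of [opval] outside of [domain]
   are irrelevant, so operators are compared through their graphs. *)
Record operator (H : Type) := Operator {
  domain : set H ;
  opval :> H -> H }.

Definition graph (H : Type) (A : operator H) : set (H * H) :=
  [set p | domain A p.1 /\ A p.1 = p.2].

Section Operators.
Variables (R : realType) (H : hilbertType R).
Implicit Types A : operator H.

Definition linear_operator A :=
  [/\ domain A 0,
      forall (c : R[i]) x y, domain A x -> domain A y -> domain A (c *: x + y) &
      forall (c : R[i]) x y, domain A x -> domain A y ->
        A (c *: x + y) = c *: A x + A y].

Definition densely_defined A := closure (domain A) = [set: H].

Definition adjoint_graph A : set (H * H) :=
  [set p | forall u, domain A u -> inner (A u) p.1 = inner u p.2].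

Definition selfadjoint A :=
  [/\ linear_operator A, densely_defined A & graph A = adjoint_graph A].

(* The order of [R[i]] makes [0 <= z] say that [z] is real and nonnegative. *)
Definition nonnegative_operator A :=
  forall u, domain A u -> 0 <= inner (A u) u.

End Operators.

(* Projection-valued measures on the Borel sets of R; the values at other sets
   are unconstrained. *)
Record pvm (R : realType) (H : hilbertType R) := PVM {
  pvm_fun :> set R -> H -> H ;
  pvm_linear : forall B, measurable B -> linear (pvm_fun B) ;
  pvm_sym : forall B, measurable B ->
    forall x y, inner (pvm_fun B x) y = inner x (pvm_fun B y) ;
  pvm0 : forall x, pvm_fun set0 x = 0 ;
  pvmT : forall x, pvm_fun setT x = x ;
  pvmI : forall B C, measurable B -> measurable C ->
    forall x, pvm_fun (B `&` C) x = pvm_fun B (pvm_fun C x) ;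
  pvm_sigma_additive : forall F : (set R)^nat,
    (forall n, measurable (F n)) -> trivIset setT F ->
    forall x, (fun n => \sum_(k < n) pvm_fun (F k) x) @ \oo -->
              pvm_fun (\bigcup_n F n) x }.

Section SpectralMeasure.
Variables (R : realType) (H : hilbertType R) (E : pvm H).

(* The measure B |-> <E(B)x, x>; for Borel sets this equals ||E(B)x||^2, which
   is also nonnegative on the junk values of E at the other sets. *)
Definition spectral_measure (x : H) (B : set R) : \bar R :=
  ((complex.Re `|E B x|) ^+ 2)%:E.

Variable x : H.

Let spectral_measure0 : spectral_measure x set0 = 0%E.
Proof. by rewrite /spectral_measure pvm0 normr0 /= expr0n. Qed.

Let spectral_measure_ge0 B : (0 <= spectral_measure x B)%E.
Proof. by rewrite lee_fin sqr_ge0. Qed.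

Let nR (y : H) : `|y| = (complex.Re `|y|)%:C.
Proof. by rewrite RRe_real// normr_real. Qed.

Let inner_proj B C y : measurable B -> measurable C ->
  inner (E B y) (E C y) = inner (E (B `&` C) y) y.
Proof. by move=> mB mC; rewrite setIC -pvm_sym// -pvmI// setIC. Qed.

Let sum_sqr_norm (F : (set R)^nat) n : (forall k, measurable (F k)) ->
    trivIset setT F ->
  (\sum_(0 <= k < n) spectral_measure x (F k) =
   ((complex.Re `|(\sum_(k < n) E (F k) x)%R|) ^+ 2)%:E)%E.
Proof.
move=> mF tF; rewrite sumEFin; congr _%:E.
have nsqr (y : H) : ((complex.Re `|y|) ^+ 2)%:C = inner y y.
  by rewrite -sqr_norm_inner [in RHS]nR -rmorphXn.
apply: (@complexI R); rewrite nsqr big_mkord rmorph_sum/=.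
rewrite linear_sumlz; apply: eq_bigr => k _.
rewrite [LHS]nsqr linear_sumr (bigD1 k)//= big1 ?addr0//.
move=> j jk; rewrite inner_proj//.
have -> : F k `&` F j = set0.
  by move/trivIsetP: tF; apply => //; rewrite eq_sym.
by rewrite pvm0 linear0l.
Qed.

Let spectral_measure_sigma_additive :
  semi_sigma_additive (spectral_measure x).
Proof.
move=> F mF tF _.
under eq_fun do rewrite sum_sqr_norm//.
apply: cvg_EFin; first exact: nearW.
suff h : (fun n => complex.Re `|\sum_(k < n) E (F k) x|) @ \oo -->
         complex.Re `|E (\bigcup_n F n) x|.
  rewrite [X in X @ _ --> _](_ : _ =
    (fun n => complex.Re `|\sum_(k < n) E (F k) x|) \*
    (fun n => complex.Re `|\sum_(k < n) E (F k) x|)).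
    by rewrite /spectral_measure expr2; exact: cvgM.
  by apply/funext => n; rewrite /= expr2.
apply/cvgrPdist_lt => e e0.
have /cvgrPdist_lt/(_ e%:C) := @pvm_sigma_additive _ _ E F mF tF x.
rewrite ltcR => /(_ e0); apply: filterS => n /= hn.
rewrite -ltcR; apply: le_lt_trans hn.
apply: le_trans (ler_dist_dist _ _).
rewrite [X in _ <= `|X - _|]nR [X in _ <= `|_ - X|]nR -rmorphB.
by rewrite normc_def /= expr0n /= addr0 sqrtr_sqr.
Qed.

HB.instance Definition _ := isMeasure.Build _ _ _ (spectral_measure x)
  spectral_measure0 spectral_measure_ge0 spectral_measure_sigma_additive.

End SpectralMeasure.

Section SpectralCalculus.
Variables (R : realType) (H : hilbertType R).
Implicit Types (E : pvm H) (phi : R -> R[i]).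

Definition complex_integral (mu : {measure set R -> \bar R}) phi : R[i] :=
  (\int[mu]_s complex.Re (phi s)) +i* (\int[mu]_s complex.Im (phi s)).

(* The integral of phi against the complex measure B |-> <E(B)x, y>, expressed
   by polarization through the measures B |-> <E(B)z, z>. *)
Definition spectral_form E phi (x y : H) : R[i] :=
  4^-1 * \sum_(k < 4)
    'i ^+ k * complex_integral (spectral_measure E (x + 'i ^+ k *: y)) phi.

(* D(phi(E)) = {x | \int |phi|^2 d<E x, x> < oo}. *)
Definition calculus_domain E phi : set H :=
  [set x | (\int[spectral_measure E x]_s
              (complex.Re `|phi s| ^+ 2)%:E < +oo)%E].

(* phi(E)x is the vector v such that <v, y> = \int phi d<E x, y>; letting y
   range over the dense subspace D(phi(E)) determines v, and makes every
   integral in the polarization formula absolutely convergent. *)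
Definition calculus E phi : operator H := {|
  domain := calculus_domain E phi ;
  opval x := xget 0 [set v | forall y, calculus_domain E phi y ->
                      inner v y = spectral_form E phi x y] |}.

(* L = \int s dE(s). By the spectral theorem every selfadjoint operator L has
   exactly one spectral measure E; the operators phi(L) of the spectral calculus
   are the operators [calculus E phi] for that E. *)
Definition is_spectral_measure E (L : operator H) :=
  graph L = graph (calculus E (fun s => s%:C)).

(* L^n *)
Definition oppow E (n : nat) : operator H := calculus E (fun s => (s ^+ n)%:C).

(* exp(-tL) *)
Definition heat E (t : R) : operator H :=
  calculus E (fun s => (expR (- (t * s)))%:C).

(* exp(-itL) *)
Definition unitary_group E (t : R) : operator H :=
  calculus E (fun s => cos (t * s) -i* sin (t * s)).

(* d_L(f, g), for the L with spectral measure E; the infimum of the empty set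
   is +oo. *)
Definition dL E (f g : H) : \bar R :=
  ereal_inf [set (n%:R)%:E | n in [set n : nat | inner f (oppow E n g) != 0]].

End SpectralCalculus.

(* Main.v *)
(* The weak Taylor formula: integrating
     |exp(w x) - \sum_(k < n) w^k x^k / k!| <= x^n   (x >= 0, w = -1 or w = -i)
   at x = t s against the spectral measures of the vectors g + i^k f yields, by
   polarization,
     <exp(w t L) g, f> = \sum_(k < n) (w t)^k / k! <L^k g, f> + O(t^n),
   uniformly in t >= 0.  The first nonzero coefficient is the one of index
   d_L(f, g), which gives the logarithmic asymptotics; if they all vanish, only
   the remainder is left.  Two facts about the spectral calculus are needed: the
   vectors phi(E)x defined weakly do exist (limits of simple functions of E),
   and E(]-oo, 0[) kills the domain of L, because u = E(]-oo, 0[) z satisfies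
   <L u, u> >= 0 while its spectral measure is carried by ]-oo, 0[. *)

Require Import Defs.
From HB Require Import structures.
From mathcomp Require Import all_boot all_order all_algebra.
From mathcomp Require Import sesquilinear complex.
From mathcomp Require Import all_classical all_reals all_analysis.
From mathcomp Require Import measurable_realfun ring lra.

Set Implicit Arguments.
Unset Strict Implicit.
Unset Printing Implicit Defensive.
Import Order.TTheory GRing.Theory Num.Theory.
Import numFieldTopology.Exports numFieldNormedType.Exports.
Import HBNNSimple.
Local Open Scope classical_set_scope.
Local Open Scope ring_scope.
Local Open Scope complex_scope.

(** * Polarization *)

Section Polarization.
Variables (R : realType) (H : hilbertType R).
Implicit Types (x y z : H) (c : R[i]).

Definition sqnorm x : R := complex.Re `|x| ^+ 2.

Lemma normH_Re x : `|x| = (complex.Re `|x|)%:C.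
Proof. by rewrite RRe_real// normr_real. Qed.

Lemma sqnormE x : (sqnorm x)%:C = inner x x.
Proof. by rewrite -sqr_norm_inner [in RHS]normH_Re -rmorphXn. Qed.

Lemma conjC_real (a : R) : Num.conj a%:C = a%:C.
Proof. exact: conjc_real. Qed.

Lemma innerC x y : inner x y = Num.conj (inner y x).
Proof. by rewrite (hermC (@inner R H)) expr0 mul1r. Qed.

Lemma innerDl x y z : inner (x + y) z = inner x z + inner y z.
Proof. exact: linearDl. Qed.

Lemma innerDr x y z : inner x (y + z) = inner x y + inner x z.
Proof. exact: linearDr. Qed.

Lemma innerNl x y : inner (- x) y = - inner x y.
Proof. exact: linearNl. Qed.

Lemma innerNr x y : inner x (- y) = - inner x y.
Proof. exact: linearNr. Qed.

Lemma innerZl c x y : inner (c *: x) y = c * inner x y.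
Proof. exact: linearZl_LR. Qed.

Lemma innerZr c x y : inner x (c *: y) = Num.conj c * inner x y.
Proof. exact: linearZr_LR. Qed.

Lemma sqnormZ c x : `|c| = 1 -> sqnorm (c *: x) = sqnorm x.
Proof. by move=> c1; rewrite /sqnorm normrZ c1 mul1r. Qed.

Lemma sqnorm_parallelogram x y :
  sqnorm (x + y) + sqnorm (x - y) = 2 * sqnorm x + 2 * sqnorm y.
Proof.
apply: (@complexI R); rewrite !mulr_natl !mulr2n !rmorphD/= !sqnormE.
rewrite !(innerDl, innerDr, innerNl, innerNr); ring.
Qed.

(** [spectral_form] is this expression with [a z] the integral against the measure of [z]. Keeping
    [a] arbitrary reduces identities between forms to identities between their values at the four
    vectors [x + i^k y]. *)
Definition polarize (a : H -> R[i]) x y : R[i] :=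
  4^-1 * \sum_(k < 4) 'i ^+ k * a (x + 'i ^+ k *: y).

Lemma polarizeE (a : H -> R[i]) x y : polarize a x y =
  4^-1 * (a (x + y) - a (x - y) +
          'i%R * (a (x + 'i%R *: y) - a (x - 'i%R *: y))).
Proof.
rewrite /polarize !big_ord_recl big_ord0 /=.
rewrite /bump/= expr0 expr1 !exprS !expr0 !mulr1 -expr2 sqrCi mulrN1.
rewrite !scale1r !scaleNr scale1r; ring.
Qed.

Lemma polarize_real (a : H -> R) x y : polarize (fun z => (a z)%:C) x y =
  (4^-1 * (a (x + y) - a (x - y))) +i*
  (4^-1 * (a (x + 'i%R *: y) - a (x - 'i%R *: y))).
Proof.
rewrite polarizeE -!rmorphB [RHS]complexE/= complexiE.
rewrite !rmorphM/= fmorphV rmorph_nat; ring.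
Qed.

Lemma polarize_sqnorm x y : polarize (fun z => (sqnorm z)%:C) x y = inner x y.
Proof.
rewrite polarizeE !sqnormE.
rewrite !(innerDl, innerDr, innerNl, innerNr, innerZl, innerZr).
rewrite conjCi; have i2 := sqrCi R[i].

by rewrite expr2 in i2; field: i2.
Qed.

End Polarization.

(** * Spectral measures *)

HB.instance Definition _ (R : realType) (H : hilbertType R) (E : pvm H)
    (x : H) :=
  Measure_isFinite.Build _ _ _ (spectral_measure E x)
    (fun A _ => isT).

Section SpectralMeasures.
Variables (R : realType) (H : hilbertType R) (E : pvm H).
Implicit Types (x y z : H) (A B : set R) (f : R -> \bar R).

Lemma spectral_measureE x A : spectral_measure E x A = (sqnorm (E A x))%:E.
Proof. by []. Qed.

Lemma pvmD A x y : measurable A -> E A (x + y) = E A x + E A y.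
Proof. by move=> mA; have := pvm_linear E mA 1 x y; rewrite !scale1r. Qed.

Lemma pvmZ A c x : measurable A -> E A (c *: x) = c *: E A x.
Proof.
move=> mA; have := pvm_linear E mA c x 0; rewrite !addr0 => ->.
have := pvm_linear E mA 1 0 0; rewrite !scale1r addr0 => /esym/eqP.
by rewrite -subr_eq0 addrK => /eqP ->; rewrite addr0.
Qed.

Lemma pvmN A x : measurable A -> E A (- x) = - E A x.
Proof. by move=> mA; rewrite -scaleN1r pvmZ// scaleN1r. Qed.

Lemma inner_pvm A B x y : measurable A -> measurable B ->
  inner (E A x) (E B y) = inner (E (A `&` B) x) y.
Proof. by move=> mA mB; rewrite -pvm_sym// -pvmI// setIC. Qed.

Lemma polarize_spectral_measure A x y : measurable A ->
  polarize (fun z => (sqnorm (E A z))%:C) x y = inner (E A x) y.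
Proof.
move=> mA; rewrite -[A in RHS]setIid -inner_pvm// -polarize_sqnorm.
by rewrite /polarize; under eq_bigr do rewrite pvmD// pvmZ//.
Qed.

Lemma spectral_measureI A B x : measurable A -> measurable B ->
  spectral_measure E (E B x) A = spectral_measure E x (A `&` B).
Proof. by move=> mA mB; rewrite !spectral_measureE -pvmI. Qed.

Lemma integral_spectral_measureZ c z f : `|c| = 1 ->
  (\int[spectral_measure E (c *: z)%R]_s f s =
   \int[spectral_measure E z]_s f s)%E.
Proof.
move=> c1; apply: eq_measure_integral => A mA _.
by rewrite [LHS]spectral_measureE pvmZ// sqnormZ.
Qed.

(** The parallelogram law for the vectors [E A x] and [E A y] holds for every Borel set [A], so the
    measures themselves add up. Without subtractions the identity makes sense for infinite integrals
    too. *)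
Lemma integral_spectral_parallelogram f x y :
  measurable_fun [set: R] f -> (forall s, 0 <= f s)%E ->
  (\int[spectral_measure E (x + y)%R]_s f s +
   \int[spectral_measure E (x - y)%R]_s f s =
   2%:E * \int[spectral_measure E x]_s f s +
   2%:E * \int[spectral_measure E y]_s f s)%E.
Proof.
move=> mf f0; rewrite !mule_natl !mule2n.
rewrite -!ge0_integral_measure_add//.
apply: eq_measure_integral => A mA _.
rewrite /= /msum !big_ord_recl !big_ord0 /= /msum !big_ord_recl !big_ord0 /=.
rewrite !adde0 !spectral_measureE pvmD// pvmD// pvmN//.
rewrite -!EFinD sqnorm_parallelogram; congr _%:E; ring.
Qed.

Lemma spectral_integralD_lty f x y :
  measurable_fun [set: R] f -> (forall s, 0 <= f s)%E ->
  (\int[spectral_measure E x]_s f s < +oo ->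
   \int[spectral_measure E y]_s f s < +oo ->
   \int[spectral_measure E (x + y)%R]_s f s < +oo)%E.
Proof.
move=> mf f0 fx fy.
apply: (@le_lt_trans _ _ (\int[spectral_measure E (x + y)%R]_s f s +
   \int[spectral_measure E (x - y)%R]_s f s)%E).
  by rewrite leeDl// integral_ge0.
rewrite integral_spectral_parallelogram// !mule_natl !mule2n.
by do ![exact: fx|exact: fy|apply: lte_add_pinfty].
Qed.

End SpectralMeasures.

(** * Real-valued integrals: finite sums, square integrability, domination *)

Section RealIntegral.
Context d (T : measurableType d) (R : realType).

Lemma Rintegral_seq_sum (mu : {measure set T -> \bar R}) (I : Type) (s : seq I)
    (f : I -> T -> R) :
  (forall i, mu.-integrable setT (EFin \o f i)) ->
  mu.-integrable setT (EFin \o fun t => \sum_(i <- s) f i t) /\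
  \int[mu]_t (\sum_(i <- s) f i t) = \sum_(i <- s) \int[mu]_t f i t.
Proof.
move=> fi; elim: s => [|i s [IHi IHe]].
  split.
    rewrite (_ : EFin \o _ = cst 0%E); first exact: integrable0.
    by apply/funext => t /=; rewrite big_nil.
  under eq_Rintegral do rewrite big_nil.
  by rewrite big_nil Rintegral_cst// mul0r.
have -> : (fun t => \sum_(j <- i :: s) f j t) =
    (fun t => f i t + \sum_(j <- s) f j t).
  by apply/funext => t; rewrite big_cons.
split; last by rewrite RintegralD// IHe big_cons.
by apply: (integrableD measurableT (fi i) IHi).
Qed.

(** On a finite measure space the bound [|h| <= 1 + h^2] suffices. *)
Lemma integrable_sqr (mu : {finite_measure set T -> \bar R}) (h : T -> R) :
  measurable_fun setT h ->
  (\int[mu]_t (h t ^+ 2)%:E < +oo)%E -> mu.-integrable setT (EFin \o h).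
Proof.
move=> mh h2.
have h2i : mu.-integrable setT (fun t => (h t ^+ 2)%:E).
  apply/integrableP; split.
    by apply/measurable_EFinP; exact: measurable_funX.
  by under eq_integral do rewrite gee0_abs ?lee_fin ?sqr_ge0//.
apply: (@le_integrable _ _ _ mu _ measurableT _ (fun t => (1 + h t ^+ 2)%:E)).
- exact/measurable_EFinP.
- move=> t _; rewrite /= lee_fin [leRHS]ger0_norm ?addr_ge0 ?sqr_ge0//.
  rewrite -[h t ^+ 2]real_normK ?num_real//.
  by move: `|h t| => a; have := sqr_ge0 (a - 1 / 2); nra.
- have i1 := finite_measure_integrable_cst mu 1 measurableT.
  exact: (integrableD measurableT i1 h2i).
Qed.

Lemma Rintegral_dominated_cvg (mu : {measure set T -> \bar R})
    (g : (T -> R)^nat) (h : T -> R) :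
  (forall n, measurable_fun setT (g n)) ->
  (forall t, g ^~ t @ \oo --> h t) ->
  (forall n t, `|g n t| <= h t) ->
  mu.-integrable setT (EFin \o h) ->
  (fun n => \int[mu]_t g n t) @ \oo --> \int[mu]_t h t.
Proof.
move=> mg gh gle ih; apply: fine_cvg.
rewrite fineK; last exact: integrable_fin_num.
apply: (@dominated_cvg _ _ _ mu _ measurableT _ _ (EFin \o h)) => //.
- by move=> n; exact/measurable_EFinP.
- by move=> t _; apply: cvg_EFin; [exact: nearW|exact: gh].
- by move=> n t _; rewrite /= lee_fin.
Qed.

(** The bound has [|g|] because [g] dominates only almost everywhere and may be negative on the
    exceptional set, while the comparison of integrals asks for integrands nonnegative
    everywhere. *)
Lemma ae_le_integrable (mu : {measure set T -> \bar R}) (f g : T -> R) :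
  measurable_fun setT f -> mu.-integrable setT (EFin \o g) ->
  {ae mu, forall t, `|f t| <= g t} ->
  mu.-integrable setT (EFin \o f) /\ `|\int[mu]_t f t| <= \int[mu]_t `|g t|.
Proof.
move=> mf ig fg; have /integrableP[mg gy] := ig.
have le : (\int[mu]_t `|(f t)%:E| <= \int[mu]_t `|(g t)%:E|)%E.
  apply: ae_ge0_le_integral => //.
  - by apply: measurableT_comp => //; exact/measurable_EFinP.
  - exact: measurableT_comp.
  - apply: filterS fg => t fgt _; rewrite /= lee_fin.
    by rewrite (le_trans fgt)// ler_norm.
have fi : mu.-integrable setT (EFin \o f).
  by apply/integrableP; split; [exact/measurable_EFinP|exact: le_lt_trans gy].
split => //; apply: (le_trans (le_normr_Rintegral _ _)) => //.
rewrite /Rintegral fine_le//.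
- by apply: integrable_fin_num => //; exact: integrable_abse fi.
- by apply: integrable_fin_num => //; exact: integrable_abse ig.
Qed.

End RealIntegral.

(** * Simple functions of the spectral measure *)

Section SimpleFunctions.
Variables (R : realType) (H : hilbertType R) (E : pvm H).
Implicit Types (x y z : H) (h k : {nnsfun measurableTypeR R >-> R}).

Definition fvalues h : seq R := finmap.enum_fset (fset_set (range h)).

Lemma nnsfunE h s :
  h s = \sum_(r <- fvalues h) r * \1_(h @^-1` [set r]) s.
Proof. by rewrite [LHS]fimfunE fsbig_finite. Qed.

(** The vector [h(E) x], the integral of the simple function [h] against [E], applied to [x]. *)
Definition sfun_pvm h x : H :=
  \sum_(r <- fvalues h) r%:C *: E (h @^-1` [set r]) x.

Lemma measurable_fiber h r : measurable (h @^-1` [set r] : set R).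
Proof. exact: (measurable_funPTI h (measurable_set1 r)). Qed.

Lemma Rintegral_spectral_indic x (A : set R) r : measurable A ->
  (spectral_measure E x).-integrable setT (EFin \o fun s => r * \1_A s) /\
  \int[spectral_measure E x]_s (r * \1_A s) = r * sqnorm (E A x).
Proof.
move=> mA; have iA := integrable_indic (spectral_measure E x) mA.
split; last by rewrite RintegralZl// /Rintegral integral_indic// setIT.
exact: (integrableZl measurableT r iA).
Qed.

Lemma inner_suml (I : Type) (s : seq I) (u : I -> H) y :
  inner (\sum_(i <- s) u i) y = \sum_(i <- s) inner (u i) y.
Proof. exact: linear_sumlz. Qed.

Lemma inner_sumr (I : Type) (s : seq I) (u : I -> H) y :
  inner y (\sum_(i <- s) u i) = \sum_(i <- s) inner y (u i).
Proof. exact: linear_sumr. Qed.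

Lemma inner_sfun_pvm h x y : inner (sfun_pvm h x) y =
  polarize (fun z => (\int[spectral_measure E z]_s h s)%:C) x y.
Proof.
have intE z : \int[spectral_measure E z]_s h s =
    \sum_(r <- fvalues h) r * sqnorm (E (h @^-1` [set r]) z).
  have ih r := Rintegral_spectral_indic z r (measurable_fiber h r).
  under eq_Rintegral do rewrite nnsfunE.
  rewrite (Rintegral_seq_sum _ (fun r => (ih r).1)).2.
  by apply: eq_bigr => r _; rewrite (ih r).2.
rewrite inner_suml /polarize.
under [in RHS]eq_bigr do rewrite intE rmorph_sum/= mulr_sumr.
rewrite exchange_big/= mulr_sumr; apply: eq_bigr => r _.
rewrite innerZl -polarize_spectral_measure; last exact: measurable_fiber.
rewrite /polarize mulrCA; congr (_ * _); rewrite mulr_sumr.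
by apply: eq_bigr => j _; rewrite [in RHS]rmorphM/= mulrCA.
Qed.

(** Projections of two fibers compose to the projection of their intersection, on which [h * k] is
    constant. This isometry turns distances between approximating vectors into distances in L2 of
    the measure of [x]. *)
Lemma inner_sfun_pvm2 h k x : inner (sfun_pvm h x) (sfun_pvm k x) =
  (\int[spectral_measure E x]_s (h s * k s))%:C.
Proof.
pose c r q s : R := r * q * \1_(h @^-1` [set r] `&` k @^-1` [set q]) s.
have hkE s : h s * k s = \sum_(r <- fvalues h) \sum_(q <- fvalues k) c r q s.
  rewrite nnsfunE (nnsfunE k) mulr_suml; apply: eq_bigr => r _.
  rewrite mulr_sumr; apply: eq_bigr => q _.
  by rewrite /c indicI/= mulrACA.
have mc r q : measurable (h @^-1` [set r] `&` k @^-1` [set q] : set R).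
  by apply: measurableI; exact: measurable_fiber.
have ic r q := Rintegral_spectral_indic x (r * q) (mc r q).
have ics r := Rintegral_seq_sum (fvalues k) (fun q => (ic r q).1).
under eq_Rintegral do rewrite hkE.
rewrite (Rintegral_seq_sum _ (fun r => (ics r).1)).2.
rewrite inner_suml rmorph_sum; apply: eq_bigr => r _ /=.
rewrite (ics r).2 inner_sumr rmorph_sum; apply: eq_bigr => q _ /=.
rewrite (ic r q).2 innerZl innerZr conjC_real mulrA.
rewrite inner_pvm; [|exact: measurable_fiber..].
rewrite 2!rmorphM/= sqnormE; congr (_ * _).
by rewrite inner_pvm// setIid.
Qed.

End SimpleFunctions.

(** * Existence of the functional calculus *)

Section CalculusExistence.
Variables (R : realType) (H : hilbertType R) (E : pvm H).
Implicit Types (x y z v : H) (h k : R -> R).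

Lemma Re_norm_ge0 x : 0 <= complex.Re `|x|.
Proof. by have := normr_ge0 x; rewrite lecE => /andP[]. Qed.

Lemma cvg_sqnorm (u : nat -> H) v : u @ \oo --> v ->
  (fun n => sqnorm (u n)) @ \oo --> sqnorm v.
Proof.
move=> uv.
suff h : (fun n => complex.Re `|u n|) @ \oo --> complex.Re `|v|.
  by rewrite /sqnorm expr2; under eq_fun do rewrite expr2; exact: cvgM.
apply/cvgrPdist_lt => e e0.
have /cvgrPdist_lt/(_ e%:C) := uv; rewrite ltcR => /(_ e0).
apply: filterS => n /= hn; rewrite -ltcR; apply: le_lt_trans hn.
apply: le_trans (ler_dist_dist _ _).
rewrite [X in _ <= `|X - _|]normH_Re [X in _ <= `|_ - X|]normH_Re -rmorphB.
by rewrite normc_def /= expr0n /= addr0 sqrtr_sqr.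
Qed.

Lemma cvg_polarize_real (w : nat -> R[i]) (a : nat -> H -> R) (b : H -> R) x y :
  (forall n, w n = polarize (fun z => (a n z)%:C) x y) ->
  (forall k : 'I_4, (fun n => a n (x + 'i%R ^+ k *: y)) @ \oo -->
    b (x + 'i%R ^+ k *: y)) ->
  (fun n => complex.Re (w n)) @ \oo -->
     complex.Re (polarize (fun z => (b z)%:C) x y) /\
  (fun n => complex.Im (w n)) @ \oo -->
     complex.Im (polarize (fun z => (b z)%:C) x y).
Proof.
move=> wE ab; rewrite polarize_real /=.
have i2 : 'i%R ^+ 2 *: y = - y by rewrite sqrCi scaleN1r.
have i3 : 'i%R ^+ 3 *: y = - ('i%R *: y).
  by rewrite exprS sqrCi mulrN1 scaleNr.
have := ab (@Ordinal 4 0 isT); rewrite /= expr0 scale1r => a0.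
have := ab (@Ordinal 4 1 isT); rewrite /= expr1 => a1.
have := ab (@Ordinal 4 2 isT); rewrite /= i2 => a2.
have := ab (@Ordinal 4 3 isT); rewrite /= i3 => a3.
split; under eq_fun do rewrite wE polarize_real /=.
  by apply: cvgM; [exact: cvg_cst|exact: cvgB].
by apply: cvgM; [exact: cvg_cst|exact: cvgB].
Qed.

Lemma cvg_inner (u : nat -> H) v y : u @ \oo --> v ->
  (fun n => complex.Re (inner (u n) y)) @ \oo --> complex.Re (inner v y) /\
  (fun n => complex.Im (inner (u n) y)) @ \oo --> complex.Im (inner v y).
Proof.
move=> uv; have c z : (fun n => sqnorm (u n + z)) @ \oo --> sqnorm (v + z).
  by apply: cvg_sqnorm; apply: cvgD uv _; exact: cvg_cst.
(* Polarizing at base point 0 moves [w] into the function. The four evaluation points then do not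
   vary with [n], and continuity of the norm is enough. *)
have e w : inner w y = polarize (fun z => (sqnorm (w + z))%:C) 0 y.
  rewrite -polarize_sqnorm /polarize.
  by under [in RHS]eq_bigr do rewrite add0r.
rewrite e; apply: (cvg_polarize_real (fun n => e (u n))
  (b := fun z => sqnorm (v + z))) => k.
exact: c.
Qed.

Definition square_integrable h z :=
  (\int[spectral_measure E z]_s (h s ^+ 2)%:E < +oo)%E.

Lemma square_integrable_le h k z :
  measurable_fun setT h -> measurable_fun setT k ->
  (forall s, h s ^+ 2 <= k s) ->
  (\int[spectral_measure E z]_s (k s)%:E < +oo)%E -> square_integrable h z.
Proof.
move=> mh mk hk; apply: le_lt_trans; apply: ge0_le_integral => //.
- by move=> s _; rewrite lee_fin sqr_ge0.
- by apply/measurable_EFinP; exact: measurable_funX.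
- exact/measurable_EFinP.
- by move=> s _; rewrite lee_fin.
Qed.

Lemma square_integrableD h c x y : measurable_fun setT h -> `|c| = 1 ->
  square_integrable h x -> square_integrable h y ->
  square_integrable h (x + c *: y).
Proof.
move=> mh c1 hx hy; apply: spectral_integralD_lty hx _.
- by apply/measurable_EFinP; exact: measurable_funX.
- by move=> s; rewrite lee_fin sqr_ge0.
- by rewrite integral_spectral_measureZ.
Qed.

Lemma normXi (k : nat) : `|('i : R[i])%R ^+ k| = 1.
Proof. by rewrite normrX normCi expr1n. Qed.

(** Take simple functions increasing to [h]. Their vectors applied to [x] form a Cauchy sequence,
    whose limit is [v]; its inner products with [y] are identified by dominated convergence against
    the four measures of [x + i^k y]. *)
Lemma nonneg_calculus_exists h x : measurable_fun setT h ->
  (forall s, 0 <= h s) -> square_integrable h x ->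
  exists v, forall y, square_integrable h y ->
    inner v y = polarize (fun z => (\int[spectral_measure E z]_s h s)%:C) x y.
Proof.
move=> mh h0 hx.
have [g [g_nd g_cvg]] := approximation (@measurableT _ (measurableTypeR R))
  ((measurable_EFinP _ _).2 mh) (fun s _ => h0 s : (0 <= (h s)%:E)%E).
have gh s : (fun n => g n s) @ \oo --> h s.
  exact: (fine_cvg (g_cvg s I)).
have ndg s : nondecreasing_seq (fun n => g n s).
  by move=> m n mn; exact/lefP/g_nd.
have gle n s : g n s <= h s.
  rewrite -(cvg_lim _ (gh s))//; apply: nondecreasing_cvgn_le (ndg s) _ n.
  by apply/cvg_ex; exists (h s); exact: gh.
have g0 n s : 0 <= g n s by [].
have mg n : measurable_fun setT (g n : R -> R).
  exact: (@measurable_funPT _ _ _ _ (g n)).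
have gint z : square_integrable h z ->
    (fun n => \int[spectral_measure E z]_s g n s) @ \oo -->
    \int[spectral_measure E z]_s h s.
  move=> hz; apply: Rintegral_dominated_cvg => //.
  - by move=> n s; rewrite ger0_norm.
  - exact: integrable_sqr.
(* By the isometry, [a n] is the squared norm of the n-th approximating vector. *)
pose a n := \int[spectral_measure E x]_s (g n s ^+ 2).
have mh2 : measurable_fun setT (fun s => h s ^+ 2) by exact: measurable_funX.
have ih2 : (spectral_measure E x).-integrable setT (fun s => (h s ^+ 2)%:E).
  apply/integrableP; split; first exact/measurable_EFinP.
  by under eq_integral do rewrite gee0_abs ?lee_fin ?sqr_ge0//.
have g2le n s : g n s ^+ 2 <= h s ^+ 2 by rewrite ler_sqr ?nnegrE.
have ca : a @ \oo --> \int[spectral_measure E x]_s (h s ^+ 2).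
  apply: Rintegral_dominated_cvg => //.
  - by move=> n; exact: measurable_funX 2 (mg n).
  - move=> s; rewrite expr2; under eq_fun do rewrite expr2.
    by apply: cvgM; exact: gh.
  - by move=> n s; rewrite ger0_norm ?sqr_ge0.
have igg m n : (spectral_measure E x).-integrable setT
    (fun s => (g m s * g n s)%:E).
  apply: (le_integrable measurableT _ _ ih2).
    by apply/measurable_EFinP; exact: measurable_funM.
  move=> s _; rewrite /= lee_fin !ger0_norm ?mulr_ge0 ?sqr_ge0//.
  by rewrite expr2 ler_pM.
pose u n := sfun_pvm E (g n) x.
(* The square expands to [a n + a m] minus twice the integral of [g n * g m], and that integral is
   at least [a m] since [g m <= g n]. *)
have dist m n : (m <= n)%N -> sqnorm (u n - u m) <= a n - a m.
  move=> mn; rewrite -lecR sqnormE.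
  rewrite !(innerDl, innerDr, innerNl, innerNr) !inner_sfun_pvm2.
  rewrite -!rmorphN -!rmorphD lecR.
  have -> : \int[spectral_measure E x]_s (g m s * g n s) =
            \int[spectral_measure E x]_s (g n s * g m s).
    by apply: eq_Rintegral => s _; rewrite mulrC.
  have : a m <= \int[spectral_measure E x]_s (g n s * g m s).
    apply: le_Rintegral => //; [exact: (igg m m)|exact: (igg n m)|].
    by move=> s _; rewrite expr2 ler_wpM2r// ndg.
  have aE i : \int[spectral_measure E x]_s (g i s * g i s) = a i by [].
  rewrite !aE; lra.
have dist' m n : sqnorm (u n - u m) <= `|a n - a m|.
  have [mn|/ltnW nm] := leqP m n.
    by rewrite (le_trans (dist _ _ mn))// ler_norm.
  rewrite -[u n - u m]opprB -scaleN1r sqnormZ ?normrN1// distrC.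
  by rewrite (le_trans (dist _ _ nm))// ler_norm.
have /cauchy_cvg/cvg_ex[v uv] : cauchy (u @ \oo).
  apply/cauchy_ballP => e; rewrite ltcE => /andP[/eqP /= e1 e2].
  (* A positive [e] of [R[i]] is real. Two terms of [a] within [e^2 / 2] of the limit differ by less
     than [e^2], which bounds the squared distance. *)
  have d0 : 0 < complex.Re e ^+ 2 / 2 by rewrite divr_gt0// exprn_gt0.
  have /cvgrPdist_lt/(_ _ d0) aN := ca.
  pose P := [set w | exists2 n, w = u n &
    `|\int[spectral_measure E x]_s (h s ^+ 2) - a n| < complex.Re e ^+ 2 / 2].
  exists (P, P).
    by split; apply: filterS aN => n an; exists n.
  move=> [_ _] /= [[n -> an] [m -> am]]; rewrite -ball_normE /=.
  rewrite normH_Re ltcE /= e1 eqxx /= -ltr_sqr ?nnegrE ?Re_norm_ge0 ?ltW//.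
  apply: le_lt_trans (dist' _ _) _.
  move: an am; rewrite !ltr_norml => /andP[? ?] /andP[? ?].
  by apply/andP; split; lra.
exists v => y hy.
have [vr vi] := cvg_inner y uv.
have [gr gi] := cvg_polarize_real
  (b := fun z => \int[spectral_measure E z]_s h s)
  (fun n => inner_sfun_pvm E (g n) x y)
  (fun i => gint _ (square_integrableD mh (normXi i) hx hy)).
apply/eqP; rewrite eq_complex; apply/andP; split; apply/eqP.
  exact: cvg_unique vr gr.
exact: cvg_unique vi gi.
Qed.

End CalculusExistence.

(** * The functional calculus for real and complex symbols *)

Section Calculus.
Variables (R : realType) (H : hilbertType R) (E : pvm H).
Implicit Types (x y z v : H) (h : R -> R) (phi : R -> R[i]).

Lemma eq_polarize (a b : H -> R[i]) x y :
  (forall k : 'I_4, a (x + 'i%R ^+ k *: y) = b (x + 'i%R ^+ k *: y)) ->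
  polarize a x y = polarize b x y.
Proof. by move=> ab; congr (_ * _); apply: eq_bigr => k _; rewrite ab. Qed.

Lemma polarizeD (a b : H -> R[i]) c x y :
  polarize (fun z => a z + c * b z) x y = polarize a x y + c * polarize b x y.
Proof. by rewrite !polarizeE; ring. Qed.

(** The vector is the difference of those for the positive and negative parts, both square
    integrable wherever [h] is. *)
Lemma calculus_exists_real h x : measurable_fun setT h ->
  square_integrable E h x ->
  exists v, forall y, square_integrable E h y ->
    inner v y = polarize (fun z => (\int[spectral_measure E z]_s h s)%:C) x y.
Proof.
move=> mh hx.
have mp : measurable_fun setT h^\+ by exact: measurable_funrpos.
have mn : measurable_fun setT h^\- by exact: measurable_funrneg.
have mh2 : measurable_fun setT (fun s => h s ^+ 2) by exact: measurable_funX.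
have lep s : h^\+ s ^+ 2 <= h s ^+ 2.
  by rewrite /funrpos; case: (leP 0 (h s)) => // ?; rewrite expr0n sqr_ge0.
have len s : h^\- s ^+ 2 <= h s ^+ 2.
  by rewrite /funrneg; case: (leP 0 (- h s)) => // ?;
    rewrite ?sqrrN// expr0n sqr_ge0.
have pint z : square_integrable E h z -> square_integrable E h^\+ z.
  exact: square_integrable_le.
have nint z : square_integrable E h z -> square_integrable E h^\- z.
  exact: square_integrable_le.
have [v1 v1P] := nonneg_calculus_exists mp (funrpos_ge0 h) (pint _ hx).
have [v2 v2P] := nonneg_calculus_exists mn (funrneg_ge0 h) (nint _ hx).
exists (v1 - v2) => y hy.
rewrite innerDl innerNl (v1P _ (pint _ hy)) (v2P _ (nint _ hy)).
rewrite -mulN1r -polarizeD; apply: eq_polarize => k.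
have hk := square_integrableD mh (normXi R k) hx hy.
rewrite mulN1r -rmorphB; congr _%:C.
rewrite -(RintegralB measurableT (integrable_sqr mp (pint _ hk))
  (integrable_sqr mn (nint _ hk))).
apply: eq_Rintegral => s _.
exact: (congr1 (fun g : R -> R => g s) (funrposBneg h)).
Qed.

Lemma sqr_Re_normc (w : R[i]) :
  complex.Re `|w| ^+ 2 = complex.Re w ^+ 2 + complex.Im w ^+ 2.
Proof. by rewrite normc_def /= sqr_sqrtr// addr_ge0 ?sqr_ge0. Qed.

Lemma calculus_domainE phi z : calculus_domain E phi z =
  (\int[spectral_measure E z]_s
     (complex.Re (phi s) ^+ 2 + complex.Im (phi s) ^+ 2)%:E < +oo)%E :> Prop.
Proof.
rewrite /calculus_domain /mkset.
by under eq_integral do rewrite sqr_Re_normc.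
Qed.

Definition measurable_funC phi :=
  measurable_fun setT (fun s => complex.Re (phi s)) /\
  measurable_fun setT (fun s => complex.Im (phi s)).

Lemma domain_square_integrable phi z : measurable_funC phi ->
  calculus_domain E phi z ->
  square_integrable E (fun s => complex.Re (phi s)) z /\
  square_integrable E (fun s => complex.Im (phi s)) z.
Proof.
move=> [mr mi]; rewrite calculus_domainE.
have m2 : measurable_fun setT
    (fun s => complex.Re (phi s) ^+ 2 + complex.Im (phi s) ^+ 2).
  by apply: measurable_funD; exact: measurable_funX.
move=> dz; split; apply: (square_integrable_le _ m2 _ dz) => //.
  by move=> s; rewrite lerDl sqr_ge0.
by move=> s; rewrite lerDr sqr_ge0.
Qed.

(** The choice operator [xget] returns a vector with the defining property as soon as one exists;
    here it is [v1 + i v2], built from the real and imaginary parts of [phi]. *)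
Lemma calculusE phi x y : measurable_funC phi ->
  calculus_domain E phi x -> calculus_domain E phi y ->
  inner (calculus E phi x) y =
  polarize (fun z => complex_integral (spectral_measure E z) phi) x y.
Proof.
move=> mphi dx dy.
pose V := [set v | forall u, calculus_domain E phi u ->
  inner v u =
  polarize (fun z => complex_integral (spectral_measure E z) phi) x u].
suff : exists v, V v by move/(xgetPex 0) => /(_ y dy).
have [rx ix] := domain_square_integrable mphi dx.
have [v1 v1P] := calculus_exists_real mphi.1 rx.
have [v2 v2P] := calculus_exists_real mphi.2 ix.
exists (v1 + 'i%R *: v2) => u du.
have [ru iu] := domain_square_integrable mphi du.
rewrite innerDl innerZl v1P// v2P// -polarizeD.
apply: eq_polarize => k; rewrite /complex_integral.
by rewrite [RHS]complexE complexiE.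
Qed.

End Calculus.

(** * The spectral measure lives on the half-line *)

Section NonnegativeSpectrum.
Variables (R : realType) (H : hilbertType R) (E : pvm H).
Implicit Types (x y z u : H).

(** With [u = E B z], the pieces [u] and [z - u] stay orthogonal under every [E A]. Hence the
    measure of [z] is the sum of theirs and dominates that of [u]. *)
Lemma square_integrable_pvm (B : set R) (h : R -> R) z : measurable B ->
  measurable_fun setT h -> square_integrable E h z ->
  square_integrable E h (E B z).
Proof.
move=> mB mh; apply: le_lt_trans.
pose u := E B z.
apply: (@le_trans _ _ (\int[spectral_measure E u]_s (h s ^+ 2)%:E +
    \int[spectral_measure E (z - u)%R]_s (h s ^+ 2)%:E)%E).
  by rewrite leeDl// integral_ge0// => s _; rewrite lee_fin sqr_ge0.
rewrite -ge0_integral_measure_add//.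
- rewrite le_eqVlt; apply/orP; left; apply/eqP.
  apply: eq_measure_integral => A mA _.
  rewrite /= /msum !big_ord_recl !big_ord0 /= adde0.
  rewrite !spectral_measureE -EFinD; congr _%:E; apply: (@complexI R).
  have mAB : measurable (A `&` B : set R) by exact: measurableI.
  rewrite rmorphD/= !sqnormE pvmD// pvmN// /u -pvmI//.
  rewrite !(innerDl, innerDr, innerNl, innerNr) !inner_pvm//.
  rewrite (setIC (A `&` B) A) setIA !setIid; ring.
- by move=> s _; rewrite lee_fin sqr_ge0.
- by apply/measurable_EFinP; exact: measurable_funX.
Qed.

Definition spectral_mean u := \int[spectral_measure E u]_s s.

(** Of the four vectors [u + i^k u], the one for k = 2 is 0, and those for k = 1 and k = 3 differ by
    a unit factor, so their contributions cancel. Only [u + u] is left, and it is kept as it is: the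
    sign of its mean is all that matters. *)
Lemma inner_calculus_id u : square_integrable E id u ->
  inner (calculus E (fun s => s%:C) u) u = (4^-1 * spectral_mean (u + u))%:C.
Proof.
move=> du.
have mid : measurable_funC (fun s : R => s%:C) by split => //=.
have dC : calculus_domain E (fun s => s%:C) u.
  rewrite calculus_domainE.
  by under eq_integral do rewrite /= expr0n addr0.
rewrite calculusE//.
rewrite (@eq_polarize _ _ _ (fun z => (spectral_mean z)%:C)); last first.
  by move=> k; rewrite /complex_integral/= Rintegral_cst// mul0r.
rewrite polarize_real.
have -> : u - 'i%R *: u = (- 'i%R) *: (u + 'i%R *: u).
  rewrite scalerDr scalerA mulNr -expr2 sqrCi opprK scale1r scaleNr addrC.
  by [].
rewrite /spectral_mean /Rintegral.
rewrite (integral_spectral_measureZ E) ?normrN ?normCi// !subrr mulr0.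
have -> : (\int[spectral_measure E 0%R]_s s%:E = 0)%E.
  rewrite (eq_measure_integral mzero) ?integral_measure_zero// => A mA _.
  rewrite [LHS]spectral_measureE -(scale0r 0) pvmZ// scale0r.
  by rewrite /sqnorm normr0 /= expr0n.
by rewrite subr0.
Qed.

Lemma sqnorm_eq0 u : sqnorm u = 0 -> u = 0.
Proof.
move=> /eqP; rewrite sqrf_eq0 => /eqP u0.
by apply/normr0_eq0; rewrite normH_Re u0.
Qed.

Lemma measurable_lt0 : measurable [set s : R | s < 0].
Proof. by rewrite -set_itvNyo; exact: measurable_itv. Qed.

(** The measure of [u] is carried by the negative half-line [B], so there the integral of [|s|] is
    minus the mean, hence 0. Then [s = 0] almost everywhere on [B], which excludes 0; so [B] is
    null, and its mass is the squared norm of [u]. *)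
Lemma spectral_mean_neg0 u : square_integrable E id u ->
  E [set s | s < 0] u = u -> 0 <= spectral_mean u -> u = 0.
Proof.
set B := [set s | s < 0] => hu Eu int0.
have mB : measurable B := measurable_lt0.
have iu := integrable_sqr (@measurable_id _ _ setT) hu.
have muC : spectral_measure E u (~` B) = 0%E.
  rewrite -Eu spectral_measureI//; last exact: measurableC.
  by rewrite setICl measure0.
have iB : (spectral_measure E u).-integrable B (EFin \o id).
  exact: integrableS iu.
have intB : spectral_mean u = \int[spectral_measure E u]_(s in B) s.
  rewrite /spectral_mean /Rintegral.
  rewrite (negligible_integral (measurableC mB) measurableT iu muC).
  by rewrite setTD setCK.
have absB : (\int[spectral_measure E u]_(s in B) `|s%:E| = 0)%E.
  have -> : (\int[spectral_measure E u]_(s in B) `|s%:E| =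
             \int[spectral_measure E u]_(s in B) (-1 * s)%:E)%E.
    apply: eq_integral => s; rewrite inE /B/= => s0.
    by rewrite ltr0_norm// mulN1r.
  have iN : (spectral_measure E u).-integrable B (EFin \o (fun s => -1 * s)).
    exact: (integrableZl mB (-1) iB).
  rewrite -(fineK (integrable_fin_num mB iN)); congr _%:E.
  apply/eqP; rewrite eq_le; apply/andP; split.
    rewrite -[leLHS]/(\int[spectral_measure E u]_(s in B) (-1 * s)).
    by rewrite RintegralZl// -intB mulN1r oppr_le0.
  by apply: Rintegral_ge0 => s; rewrite /B/= mulN1r oppr_ge0 => /ltW.
apply: sqnorm_eq0.
have mBid : measurable_fun B (EFin : R -> \bar R).
  by apply/measurable_EFinP; exact: measurable_id.
have /(ae_eq_integral_abs _ mB mBid) ae0 := absB.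
have B0 : spectral_measure E u B = 0%E.
  apply/negligibleP => //; move: ae0; apply: negligibleS => s Bs /=.
  move=> /(_ Bs) [] s0; move: Bs; rewrite /B/= s0 ltxx.
  by [].
by move: B0; rewrite spectral_measureE Eu => -[].
Qed.

Lemma nonnegative_pvm_neg0 (L : operator H) z : nonnegative_operator L ->
  is_spectral_measure E L -> square_integrable E id z ->
  E [set s | s < 0] z = 0.
Proof.
move=> L_ge0 E_L hz; set u := E _ z.
have hu : square_integrable E id u.
  by apply: square_integrable_pvm => //; exact: measurable_lt0.
have hw : square_integrable E id (u + u).
  by rewrite -[X in _ + X]scale1r; apply: square_integrableD; rewrite ?normr1.
have Ew : E [set s | s < 0] (u + u) = u + u.
  rewrite pvmD; last exact: measurable_lt0.
  by rewrite /u -pvmI ?setIid//; exact: measurable_lt0.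
(* Operators are compared by their graphs, so this pair transports both the membership of [u] in the
   domain of [L] and the value [L u]. *)
have : graph (calculus E (fun s => s%:C)) (u, calculus E (fun s => s%:C) u).
  split => //=; rewrite calculus_domainE.
  by under eq_integral do rewrite /= expr0n addr0.
rewrite -E_L => -[/= dL Lu].
have := L_ge0 u dL; rewrite Lu inner_calculus_id// ler0c pmulr_rge0// => int0.
have := spectral_mean_neg0 hw Ew int0.
rewrite -mulr2n -scaler_nat => /eqP; rewrite scaler_eq0 pnatr_eq0/=.
by move/eqP.
Qed.

Lemma spectral_measure_ae_ge0 (L : operator H) z : nonnegative_operator L ->
  is_spectral_measure E L -> square_integrable E id z ->
  {ae spectral_measure E z, forall s, 0 <= s}.
Proof.
move=> L_ge0 E_L hz; exists [set s | s < 0]; split.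
- exact: measurable_lt0.
- rewrite spectral_measureE (nonnegative_pvm_neg0 L_ge0 E_L hz).
  by rewrite /sqnorm normr0/= expr0n.
- by move=> s /= /negP; rewrite -ltNge.
Qed.

End NonnegativeSpectrum.

(** * Taylor expansion of exponentials *)

Section Taylor.
Variable R : realType.

Lemma is_derive_taylor_sum (a : nat -> R) n (x : R) :
  is_derive x (1 : R) (fun y => \sum_(k < n.+1) a k * (y ^+ k / k`!%:R))
    (\sum_(k < n) a k.+1 * (x ^+ k / k`!%:R)).
Proof.
elim: n => [|n IHn].
  have -> : (fun y : R => \sum_(k < 1) a k * (y ^+ k / k`!%:R)) = cst (a 0%N).
    by apply/funext => y; rewrite big_ord1 expr0 fact0 divr1 mulr1.
  by rewrite big_ord0; exact: is_derive_cst.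
have -> : (fun y : R => \sum_(k < n.+2) a k * (y ^+ k / k`!%:R)) =
    (fun y => \sum_(k < n.+1) a k * (y ^+ k / k`!%:R)) +
    (a n.+1 / n.+1`!%:R) *: (id ^+ n.+1 : R -> R).
  apply/funext => y; rewrite big_ord_recr/=; congr (_ + _).
  by rewrite /= exprfctE -[RHS]/(_ * y ^+ n.+1) mulrCA mulrC.
rewrite big_ord_recr/=; apply: is_deriveD.
apply: (is_derive_eq (is_deriveZ _ (is_deriveX _ (is_derive_id _ _)))).
rewrite /= factS natrM /GRing.scale/=.
have n0 : n.+1%:R != 0 :> R by rewrite pnatr_eq0.
have f0 : n`!%:R != 0 :> R by rewrite pnatr_eq0 -lt0n fact_gt0.
by field; rewrite f0 addrC natr1 n0.
Qed.

(** The remainder of order [n + 1] of [f j] vanishes at 0 and its derivative is the remainder of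
    order [n] of [f j.+1]. The mean value theorem then gives the extra factor [x]; the induction
    runs over all [j] at once and gives up the factorial in the usual bound. *)
Lemma bounded_taylor (f : nat -> R -> R) :
  (forall j x, is_derive x (1 : R) (f j) (f j.+1 x)) ->
  (forall j x, 0 <= x -> `|f j x| <= 1) ->
  forall n j x, 0 <= x ->
    `|f j x - \sum_(k < n) f (j + k)%N 0 * (x ^+ k / k`!%:R)| <= x ^+ n.
Proof.
move=> df f1; elim => [|n IHn] j x x0.
  by rewrite big_ord0 subr0 expr0 f1.
pose g y := f j y - \sum_(k < n.+1) f (j + k)%N 0 * (y ^+ k / k`!%:R).
pose dg y := f j.+1 y - \sum_(k < n) f (j.+1 + k)%N 0 * (y ^+ k / k`!%:R).
have dgP y : is_derive y (1 : R) g (dg y).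
  rewrite /dg; under eq_bigr do rewrite addSnnS.
  by apply: is_deriveB; exact: (is_derive_taylor_sum (fun k => f (j + k)%N 0)).
have g0 : g 0 = 0.
  rewrite /g big_ord_recl/= addn0 expr0 fact0 divr1 mulr1.
  rewrite big1 ?addr0 ?subrr// => k _.
  by rewrite /bump/= exprS !mul0r mulr0.
have cg : {within `[0, x], continuous g}.
  apply: continuous_subspaceT => y.
  by apply: differentiable_continuous; apply/derivable1_diffP; case: (dgP y).
have [c /[!in_itv]/= /andP[c0 cx]] := MVT_segment x0 (fun y _ => dgP y) cg.
rewrite g0 !subr0 -/(g x) => ->.
rewrite normrM (ger0_norm x0) exprSr ler_wpM2r//.
by rewrite (le_trans (IHn _ _ c0))// lerXn2r.
Qed.

End Taylor.

(** * The two exponentials and their Taylor remainders *)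

Section Exponential.
Variable R : realType.
Implicit Types (w c z : R[i]) (psi : R -> R[i]).

Lemma complex_ReM c z : complex.Re (c * z) =
  complex.Re c * complex.Re z - complex.Im c * complex.Im z.
Proof. by case: c; case: z. Qed.

Lemma complex_ImM c z : complex.Im (c * z) =
  complex.Re c * complex.Im z + complex.Im c * complex.Re z.
Proof. by case: c; case: z. Qed.

Lemma complex_ReDM z c z' : complex.Re (z + c * z') = complex.Re z +
  (complex.Re c * complex.Re z' - complex.Im c * complex.Im z').
Proof. by rewrite raddfD/= complex_ReM. Qed.

Lemma complex_ImDM z c z' : complex.Im (z + c * z') = complex.Im z +
  (complex.Re c * complex.Im z' + complex.Im c * complex.Re z').
Proof. by rewrite raddfD/= complex_ImM. Qed.

Lemma normr_Re_le z : `|complex.Re z| <= Normc.normc z.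
Proof. by rewrite -lecR; exact: normc_ge_Re. Qed.

Lemma normr_Im_le z : `|complex.Im z| <= Normc.normc z.
Proof.
case: z => a b /=; rewrite -(sqrtr_sqr b) ler_wsqrtr//.
by rewrite lerDr sqr_ge0.
Qed.

Lemma normc_le_ReIm z : Normc.normc z <= `|complex.Re z| + `|complex.Im z|.
Proof.
case: z => a b /=; rewrite -[leRHS]ger0_norm ?addr_ge0// -sqrtr_sqr.
rewrite ler_wsqrtr// sqrrD !real_normK ?num_real// -addrA.
by rewrite lerD2l lerDr mulrn_wge0// mulr_ge0.
Qed.

(* The functions x |-> exp(w x), for |w| = 1 and Re w <= 0; only w = -1 and
   w = -i are needed. *)
Definition exponential w psi :=
  [/\ Normc.normc w = 1, psi 0 = 1,
      forall x : R, 0 <= x -> Normc.normc (psi x) <= 1,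
      forall x : R, is_derive x (1 : R) (fun y => complex.Re (psi y))
        (complex.Re (w * psi x)) &
      forall x : R, is_derive x (1 : R) (fun y => complex.Im (psi y))
        (complex.Im (w * psi x))].

Lemma exponential_derive w psi c : exponential w psi -> forall x : R,
  is_derive x (1 : R) (fun y => complex.Re (c * psi y))
    (complex.Re (c * (w * psi x))) /\
  is_derive x (1 : R) (fun y => complex.Im (c * psi y))
    (complex.Im (c * (w * psi x))).
Proof.
move=> [_ _ _ dRe dIm] x.
rewrite (complex_ReM c (w * psi x)) (complex_ImM c (w * psi x)).
have dR := dRe x; have dI := dIm x.
split.
  have -> : (fun y => complex.Re (c * psi y)) =
      (complex.Re c *: (fun y => complex.Re (psi y)) : R -> R) -
      (complex.Im c *: (fun y => complex.Im (psi y)) : R -> R).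
    by apply/funext => y; rewrite complex_ReM.
  by apply: is_deriveB; exact: is_deriveZ.
have -> : (fun y => complex.Im (c * psi y)) =
    (complex.Re c *: (fun y => complex.Im (psi y)) : R -> R) +
    (complex.Im c *: (fun y => complex.Re (psi y)) : R -> R).
  by apply/funext => y; rewrite complex_ImM.
by apply: is_deriveD; exact: is_deriveZ.
Qed.

Definition taylor_remainder w psi n x : R[i] :=
  psi x - \sum_(k < n) w ^+ k / k`!%:R * (x ^+ k)%:C.

Lemma normcXn w k : Normc.normc w = 1 -> Normc.normc (w ^+ k) = 1.
Proof.
move=> w1; elim: k => [|k IHk]; first by rewrite expr0 Normc.normc1.
by rewrite exprS Normc.normcM w1 IHk mulr1.
Qed.

Lemma raddfRe_sum n (F : 'I_n -> R[i]) :
  complex.Re (\sum_(k < n) F k) = \sum_(k < n) complex.Re (F k).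
Proof. exact: (raddf_sum (@complex.Re R : Rcomplex R -> R)). Qed.

Lemma raddfIm_sum n (F : 'I_n -> R[i]) :
  complex.Im (\sum_(k < n) F k) = \sum_(k < n) complex.Im (F k).
Proof. exact: (raddf_sum (@complex.Im R : Rcomplex R -> R)). Qed.

(** The real parts of [w^j psi] form a chain of successive derivatives bounded by 1 on the
    half-line, as do the imaginary parts, so [bounded_taylor] applies to each at [j = 0]. *)
Lemma exponential_taylor w psi n x : exponential w psi -> 0 <= x ->
  `|complex.Re (taylor_remainder w psi n x)| <= x ^+ n /\
  `|complex.Im (taylor_remainder w psi n x)| <= x ^+ n.
Proof.
move=> ewp x0; have [w1 psi0 psi1 _ _] := ewp.
have b1 j y : 0 <= y -> Normc.normc (w ^+ j * psi y) <= 1.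
  by move=> y0; rewrite Normc.normcM normcXn// mul1r psi1.
have coef k : w ^+ k / k`!%:R * (x ^+ k)%:C =
    w ^+ k * psi 0 * (x ^+ k / k`!%:R)%:C.
  by rewrite psi0 mulr1 rmorphM/= fmorphV/= rmorph_nat mulrAC mulrA.
have dRe j y : is_derive y (1 : R) (fun t => complex.Re (w ^+ j * psi t))
    (complex.Re (w ^+ j.+1 * psi y)).
  by rewrite exprSr -mulrA; exact: (exponential_derive _ ewp y).1.
have dIm j y : is_derive y (1 : R) (fun t => complex.Im (w ^+ j * psi t))
    (complex.Im (w ^+ j.+1 * psi y)).
  by rewrite exprSr -mulrA; exact: (exponential_derive _ ewp y).2.
rewrite /taylor_remainder raddfB/= raddfRe_sum raddfB/= raddfIm_sum; split.
  have bRe j y (y0 : 0 <= y) := le_trans (normr_Re_le _) (b1 j y y0).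
  apply: etrans (bounded_taylor dRe bRe n 0 x0).
  rewrite /= expr0 mul1r; congr (`|_ - _| <= _).
  by apply: eq_bigr => k _; rewrite coef complex_ReM/= mulr0 subr0.
have bIm j y (y0 : 0 <= y) := le_trans (normr_Im_le _) (b1 j y y0).
apply: etrans (bounded_taylor dIm bIm n 0 x0).
rewrite /= expr0 mul1r; congr (`|_ - _| <= _).
by apply: eq_bigr => k _; rewrite coef complex_ImM/= mulr0 add0r mulrC.
Qed.

Lemma measurable_exponential w psi : exponential w psi ->
  measurable_fun setT (fun x => complex.Re (psi x)) /\
  measurable_fun setT (fun x => complex.Im (psi x)).
Proof.
move=> [_ _ _ dRe dIm]; split; apply: continuous_measurable_fun => x;
  apply: differentiable_continuous; apply/derivable1_diffP.
  by case: (dRe x).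
by case: (dIm x).
Qed.

Lemma exponential_heat :
  exponential (-1) (fun x : R => (expR (- x))%:C).
Proof.
split.
- by rewrite normcN Normc.normc1.
- by rewrite oppr0 expR0.
- move=> x x0; rewrite /= expr0n addr0 sqrtr_sqr ger0_norm ?expR_ge0//.
  by rewrite -expR0 ler_expR oppr_le0.
- move=> x; rewrite mulN1r /=.
  have d := is_derive1_comp (is_derive_expR (- x))
    (is_deriveN (is_derive_id x (1 : R))).
  exact: (is_derive_eq d (mulrN1 _)).
- move=> x; have -> : complex.Im (-1 * (expR (- x))%:C) = 0.
    by rewrite mulN1r /= oppr0.
  exact: (is_derive_cst (0 : R) x (1 : R)).
Qed.

Lemma exponential_unitary :
  exponential (- 'i%R) (fun x : R => cos x -i* sin x).
Proof.
split.
- rewrite normcN -complexiE /= expr0n expr1n add0r sqrtr1. by [].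
- by rewrite cos0 sin0 oppr0.
- by move=> x _; rewrite /= sqrrN cos2Dsin2 sqrtr1.
- move=> x; rewrite mulNr -complexiE /= mul0r mul1r sub0r opprK.
  exact: is_derive_cos.
- move=> x; rewrite mulNr -complexiE /= mul0r mul1r add0r.
  exact: is_deriveN.
Qed.

End Exponential.

(** * Spectral Taylor expansion *)

Section ComplexIntegral.
Context (R : realType) (mu : {measure set R -> \bar R}).
Implicit Types phi : R -> R[i].

Definition integrableC phi :=
  mu.-integrable setT (EFin \o fun s => complex.Re (phi s)) /\
  mu.-integrable setT (EFin \o fun s => complex.Im (phi s)).

Lemma complex_integralDM phi1 phi2 c : integrableC phi1 -> integrableC phi2 ->
  integrableC (fun s => phi1 s + c * phi2 s) /\
  complex_integral mu (fun s => phi1 s + c * phi2 s) =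
  complex_integral mu phi1 + c * complex_integral mu phi2.
Proof.
move=> [r1 i1] [r2 i2].
have RZ (k : R) (h : R -> R) : mu.-integrable setT (EFin \o h) ->
    mu.-integrable setT (EFin \o (fun s => k * h s)).
  by move=> ih; exact: (integrableZl measurableT k ih).
have rB := integrableB measurableT
  (RZ (complex.Re c) _ r2) (RZ (complex.Im c) _ i2).
have iD := integrableD measurableT
  (RZ (complex.Re c) _ i2) (RZ (complex.Im c) _ r2).
have eR := funext (fun s => complex_ReDM (phi1 s) c (phi2 s)).
have eI := funext (fun s => complex_ImDM (phi1 s) c (phi2 s)).
split.
  rewrite /integrableC eR eI; split.
    exact: (integrableD measurableT r1 rB).
  exact: (integrableD measurableT i1 iD).
rewrite /complex_integral eR eI.
rewrite (RintegralD measurableT r1 rB) (RintegralD measurableT i1 iD).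
rewrite (RintegralB measurableT (RZ _ _ r2) (RZ _ _ i2)).
rewrite (RintegralD measurableT (RZ _ _ i2) (RZ _ _ r2)).
rewrite !RintegralZl//.
apply/eqP; rewrite eq_complex; apply/andP; split; apply/eqP.
  by rewrite [RHS]raddfD/= complex_ReM.
by rewrite [RHS]raddfD/= complex_ImM.
Qed.

(** The factor 2 comes from bounding a modulus by the sum of the absolute values of its coordinates.
    The domination is almost everywhere because the Taylor bound is available only for nonnegative
    arguments. *)
Lemma complex_integral_ae_le phi (h : R -> R) :
  measurable_funC phi -> mu.-integrable setT (EFin \o h) ->
  {ae mu, forall s, `|complex.Re (phi s)| <= h s /\
                    `|complex.Im (phi s)| <= h s} ->
  integrableC phi /\
  Normc.normc (complex_integral mu phi) <= 2 * \int[mu]_s `|h s|.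
Proof.
move=> [mr mi] ih hphi.
have aer : {ae mu, forall s, `|complex.Re (phi s)| <= h s}.
  by apply: filterS hphi => s [].
have aei : {ae mu, forall s, `|complex.Im (phi s)| <= h s}.
  by apply: filterS hphi => s [].
have [ir ler] := ae_le_integrable mr ih aer.
have [ii lei] := ae_le_integrable mi ih aei.
split => //; apply: le_trans (normc_le_ReIm _) _ => /=.
by rewrite mulr_natl mulr2n lerD.
Qed.

End ComplexIntegral.

(** * Taylor expansion of matrix coefficients *)

Section SpectralTaylor.
Variables (R : realType) (H : hilbertType R) (E : pvm H).
Implicit Types (x y z : H) (w : R[i]) (psi : R -> R[i]).

Lemma polarize_bound (a : H -> R[i]) x y :
  Normc.normc (polarize a x y) <=
  \sum_(k < 4) Normc.normc (a (x + 'i%R ^+ k *: y)).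
Proof.
rewrite -lecR rmorph_sum/=.
have nE (v : R[i]) : (Normc.normc v)%:C = `|v| by [].
rewrite nE; under eq_bigr do rewrite nE.
rewrite /polarize normrM normfV normr_nat.
apply: (@le_trans _ _ `|\sum_(k < 4) 'i%R ^+ k * a (x + 'i%R ^+ k *: y)|).
  by rewrite ler_piMl// invf_le1 ?ler1n.
apply: le_trans (ler_norm_sum _ _ _) _.
by apply: ler_sum => k _; rewrite normrM normXi mul1r.
Qed.

Lemma oppow_square_integrable n z : domain (oppow E n) z ->
  square_integrable E (fun s => s ^+ n) z.
Proof.
rewrite /= calculus_domainE.
by under eq_integral do rewrite /= expr0n addr0.
Qed.

Lemma measurable_funX_id n : measurable_fun setT (fun s : R => s ^+ n).
Proof. by apply: (measurable_funX n (@measurable_id _ _ setT)). Qed.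

Lemma measurable_exponential_scale w psi (t : R) : exponential w psi ->
  measurable_funC (fun s => psi (t * s)).
Proof.
move=> /measurable_exponential[mr mi].
have mt : measurable_fun setT (fun s : R => t * s).
  exact: measurable_funM.
by split; [exact: (measurableT_comp mr mt)|exact: (measurableT_comp mi mt)].
Qed.

(** The modulus of [psi] is at most 1 on the half-line that carries the measure, and the measure is
    finite. On negative [s] the heat symbol is unbounded, so positivity is essential here. *)
Lemma exponential_domain w psi (t : R) z : exponential w psi -> 0 <= t ->
  {ae spectral_measure E z, forall s, 0 <= s} ->
  calculus_domain E (fun s => psi (t * s)) z.
Proof.
move=> ewp t0 ae0; have [_ _ psi1 _ _] := ewp.
have [mr mi] := measurable_exponential_scale t ewp.
rewrite calculus_domainE.
apply: (@le_lt_trans _ _ (\int[spectral_measure E z]_s (cst 1%E) s)%E);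
  last first.
  by rewrite integral_cst// mul1e ltry.
apply: ae_ge0_le_integral => //.
- by move=> s _; rewrite lee_fin addr_ge0 ?sqr_ge0.
- by apply/measurable_EFinP; apply: measurable_funD; exact: measurable_funX.
- apply: filterS ae0 => s s0 _; rewrite /= lee_fin -sqr_Re_normc.
  rewrite expr_le1// ?psi1 ?mulr_ge0//.
  by case: (psi _) => ? ?; exact: sqrtr_ge0.
Qed.

Lemma taylor_remainder0 w psi (s : R) : taylor_remainder w psi 0 s = psi s.
Proof. by rewrite /taylor_remainder big_ord0 subr0. Qed.

(** The shape [phi1 + c * phi2] is the one for which measurability, integrability and the integral
    pass through an induction on [n]. *)
Lemma taylor_remainderS w psi n (t s : R) :
  taylor_remainder w psi n.+1 (t * s) = taylor_remainder w psi n (t * s) +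
    (- (w ^+ n / n`!%:R * (t ^+ n)%:C)) * (s ^+ n)%:C.
Proof.
rewrite /taylor_remainder big_ord_recr/= opprD addrA.
by rewrite exprMn rmorphM/= mulNr !mulrA.
Qed.

Lemma measurable_funC_DM (phi1 phi2 : R -> R[i]) c :
  measurable_funC phi1 -> measurable_funC phi2 ->
  measurable_funC (fun s => phi1 s + c * phi2 s).
Proof.
move=> [r1 i1] [r2 i2].
have MZ (k : R) (h : R -> R) : measurable_fun setT h ->
    measurable_fun setT (fun s => k * h s).
  by move=> mh; exact: measurable_funM.
split.
  under eq_fun do rewrite complex_ReDM.
  by apply: measurable_funD => //; apply: measurable_funB; exact: MZ.
under eq_fun do rewrite complex_ImDM.
by apply: measurable_funD => //; apply: measurable_funD; exact: MZ.
Qed.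

Lemma complex_integral_taylor (mu : {measure set R -> \bar R}) w psi n (t : R) :
  integrableC mu (fun s => psi (t * s)) ->
  (forall k, integrableC mu (fun s => (s ^+ k)%:C)) ->
  complex_integral mu (fun s => psi (t * s)) -
  \sum_(k < n) w ^+ k / k`!%:R * (t ^+ k)%:C *
    complex_integral mu (fun s => (s ^+ k)%:C) =
  complex_integral mu (fun s => taylor_remainder w psi n (t * s)).
Proof.
move=> ipsi ipow.
(* Integrability joins the induction because linearity of the integral requires it at each step. *)
suff : integrableC mu (fun s => taylor_remainder w psi n (t * s)) /\
  complex_integral mu (fun s => taylor_remainder w psi n (t * s)) =
  complex_integral mu (fun s => psi (t * s)) -
  \sum_(k < n) w ^+ k / k`!%:R * (t ^+ k)%:C *
    complex_integral mu (fun s => (s ^+ k)%:C) by case.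
elim: n => [|n [IHi IHe]].
  rewrite big_ord0 subr0.
  by under eq_fun do rewrite taylor_remainder0.
under eq_fun do rewrite taylor_remainderS.
have [iD ->] := complex_integralDM
  (- (w ^+ n / n`!%:R * (t ^+ n)%:C)) IHi (ipow n).
by split => //; rewrite IHe big_ord_recr/= opprD addrA mulNr.
Qed.

Lemma polarize_sum n (c : 'I_n -> R[i]) (a : 'I_n -> H -> R[i]) x y :
  polarize (fun z => \sum_(k < n) c k * a k z) x y =
  \sum_(k < n) c k * polarize (a k) x y.
Proof.
rewrite /polarize; under eq_bigr do rewrite mulr_sumr.
rewrite exchange_big mulr_sumr/=; apply: eq_bigr => k _.
rewrite mulrCA; congr (_ * _); rewrite mulr_sumr.
by apply: eq_bigr => j _; rewrite mulrCA.
Qed.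

Lemma spectral_taylor (L : operator H) w psi x y n :
  nonnegative_operator L -> is_spectral_measure E L -> exponential w psi ->
  (forall k, domain (oppow E k) x) -> (forall k, domain (oppow E k) y) ->
  exists C : R, 0 < C /\ forall t : R, 0 <= t ->
    Normc.normc (inner (calculus E (fun s => psi (t * s)) x) y -
      \sum_(k < n) w ^+ k / k`!%:R * (t ^+ k)%:C * inner (oppow E k x) y)
    <= C * t ^+ n.
Proof.
move=> L_ge0 E_L ewp dx dy.
have sx k := oppow_square_integrable (dx k).
have sy k := oppow_square_integrable (dy k).
pose z (k : 'I_4) := x + 'i%R ^+ k *: y.
have sz m k : square_integrable E (fun s => s ^+ m) (z k).
  exact: (square_integrableD (measurable_funX_id m) (normXi R k) (sx m) (sy m)).
(* [s ^+ 1] reduces to [s]: the case k = 1 of smoothness, membership in the domain of [L], confines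
   the measure to the half-line. *)
have ae0 v : square_integrable E (fun s => s ^+ 1) v ->
    {ae spectral_measure E v, forall s, 0 <= s}.
  exact: spectral_measure_ae_ge0 L_ge0 E_L.
have iz m k : (spectral_measure E (z k)).-integrable setT
    (EFin \o (fun s => s ^+ m)).
  exact: integrable_sqr (measurable_funX_id m) (sz m k).
(* The bound [(t s)^n] splits off [t^n], leaving absolute n-th moments independent of [t]. Adding 1
   afterwards makes the constant strictly positive. *)
pose C := \sum_(k < 4) 2 * \int[spectral_measure E (z k)]_s `|s ^+ n|.
have C0 : 0 <= C by apply: sumr_ge0 => k _; rewrite mulr_ge0// Rintegral_ge0.
exists (C + 1); split; first by rewrite ltr_wpDl.
move=> t t0.
have mpsi := measurable_exponential_scale t ewp.
have mpow m : measurable_funC (fun s : R => (s ^+ m)%:C).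
  by split; [exact: measurable_funX_id|exact: measurable_cst].
have ipow m k : integrableC (spectral_measure E (z k)) (fun s => (s ^+ m)%:C).
  by split; [exact: iz|exact: integrable0].
have mrem m : measurable_funC (fun s => taylor_remainder w psi m (t * s)).
  elim: m => [|m IHm]; first by under eq_fun do rewrite taylor_remainder0.
  under eq_fun do rewrite taylor_remainderS.
  exact: measurable_funC_DM.
have bound m k : integrableC (spectral_measure E (z k))
      (fun s => taylor_remainder w psi m (t * s)) /\
    Normc.normc (complex_integral (spectral_measure E (z k))
      (fun s => taylor_remainder w psi m (t * s))) <=
    2 * \int[spectral_measure E (z k)]_s `|t ^+ m * s ^+ m|.
  apply: complex_integral_ae_le => //.
    exact: (integrableZl measurableT (t ^+ m) (iz m k)).
  apply: filterS (ae0 _ (sz 1 k)) => s s0.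
  by rewrite -exprMn; apply: exponential_taylor => //; rewrite mulr_ge0.
have ipsi k : integrableC (spectral_measure E (z k)) (fun s => psi (t * s)).
  have [+ _] := bound 0%N k.
  by under eq_fun do rewrite taylor_remainder0.
rewrite (calculusE mpsi (exponential_domain ewp t0 (ae0 _ (sx 1)))
  (exponential_domain ewp t0 (ae0 _ (sy 1)))).
under eq_bigr do rewrite (calculusE (mpow _) (dx _) (dy _)).
rewrite -polarize_sum -mulN1r -polarizeD.
rewrite (@eq_polarize _ _ _ (fun v => complex_integral (spectral_measure E v)
  (fun s => taylor_remainder w psi n (t * s)))); last first.
  move=> k; rewrite mulN1r.
  exact: complex_integral_taylor (ipsi k) (fun m => ipow m k).
apply: le_trans (polarize_bound _ _ _) _.
apply: (@le_trans _ _ (C * t ^+ n)); last first.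
  by rewrite ler_wpM2r ?exprn_ge0// lerDl.
rewrite mulr_suml; apply: ler_sum => k _.
apply: le_trans (bound n k).2 _; rewrite -mulrA ler_wpM2l//.
under eq_Rintegral do rewrite normrM (ger0_norm (exprn_ge0 _ t0)).
rewrite RintegralZl//; first by rewrite mulrC.
exact: integrable_norm (iz n k).
Qed.

End SpectralTaylor.

(** * Short-time asymptotics *)

Section LogAsymptotics.
Variable R : realType.

(** For small [t] the value [F t] lies between fixed positive multiples of [t^d], so
    [ln (F t) - d ln t] is bounded, and dividing by [ln t], which tends to minus infinity, makes it
    vanish. *)
Lemma ln_ratio_cvg (F : R -> R) (a C : R) (d : nat) : 0 < a -> 0 < C ->
  (forall t, 0 <= t -> `|F t - a * t ^+ d| <= C * t ^+ d.+1) ->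
  (lne (F t)%:E / lne t%:E)%E @[t --> 0^'+] --> (d%:R : R)%:E.
Proof.
move=> a0 C0 Fa.
(* Below this threshold the error [C t^(d+1)] is at most half of the main term. *)
have small (t : R) : 0 < t -> t < a / 2 / C ->
    a / 2 * t ^+ d <= F t <= 2 * a * t ^+ d.
  move=> t0 tC; have td : 0 < t ^+ d by rewrite exprn_gt0.
  have CtA : C * t ^+ d.+1 <= a / 2 * t ^+ d.
    rewrite exprS mulrA; apply: ler_wpM2r; first exact: ltW.
    by rewrite mulrC -ler_pdivlMr// ltW.
  move: (Fa t (ltW t0)); rewrite ler_norml => /andP[lo hi].
  have : 0 < a * t ^+ d by rewrite mulr_gt0.
  move=> ?; apply/andP; split; lra.
have lnF (t : R) : 0 < t -> t < a / 2 / C ->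
    ln (a / 2) <= ln (F t) - d%:R * ln t <= ln (2 * a).
  move=> t0 tC; have /andP[lo hi] := small t t0 tC.
  have td : 0 < t ^+ d by rewrite exprn_gt0.
  have F0 : 0 < F t by apply: lt_le_trans lo; rewrite !mulr_gt0// invr_gt0.
  have -> : d%:R * ln t = ln (t ^+ d) by rewrite lnXn// mulr_natl.
  rewrite lerBrDr lerBlDr -!lnM ?posrE// ?mulr_gt0 ?invr_gt0//.
  by rewrite !ler_ln ?posrE ?lo ?hi// !mulr_gt0// invr_gt0.
pose M := `|ln (a / 2)| + `|ln (2 * a)| + 1.
have M0 : 0 < M by rewrite /M ltr_wpDl// addr_ge0.
have aC0 : 0 < a / 2 / C by rewrite !divr_gt0.
(* Near 0 both [F t > 0] and [t < 1] hold, so no infinite logarithm and no division by zero occurs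
   and the extended quotient is the real one. *)
have near1 : \forall t \near 0^'+,
    (ln (F t) / ln t)%:E = (lne (F t)%:E / lne t%:E)%E.
  near=> t.
  have t0 : 0 < t by near: t; exact: nbhs_right_gt.
  have t1 : t < 1 by near: t; exact: nbhs_right_lt.
  have tC : t < a / 2 / C by near: t; exact: nbhs_right_lt.
  have /andP[lo _] := small t t0 tC.
  have F0 : 0 < F t.
    by apply: lt_le_trans lo; rewrite !mulr_gt0 ?invr_gt0// exprn_gt0.
  rewrite !lne_EFin// inver ln_eq0// (lt_eqF t1).
  by rewrite EFinM.
apply: cvg_trans (near_eq_cvg near1) _.
apply: cvg_EFin; first exact: nearW.
apply/cvgrPdist_lt => e e0; near=> t.
have t0 : 0 < t by near: t; exact: nbhs_right_gt.
have tC : t < a / 2 / C by near: t; exact: nbhs_right_lt.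
(* This makes [|ln t|] exceed [M / e], where [M] bounds [|ln (F t) - d ln t|]. *)
have te : t < expR (- (M / e)).
  by near: t; apply: nbhs_right_lt; exact: expR_gt0.
have lnt : ln t < - (M / e).
  by rewrite -ltr_expR lnK.
have lnt0 : ln t < 0.
  by apply: lt_trans lnt _; rewrite oppr_lt0 divr_gt0.
rewrite /= distrC.
have -> : ln (F t) / ln t - d%:R = (ln (F t) - d%:R * ln t) / ln t.
  by field; rewrite lt_eqF.
rewrite normrM normfV ltr_pdivrMr ?normr_gt0 ?lt_eqF//.
apply: (@lt_trans _ _ M).
  have /andP[lo hi] := lnF t t0 tC.
  rewrite ltr_norml; apply/andP; split.
    apply: lt_le_trans lo; rewrite ltrNl.
    apply: le_lt_trans (ler_norm _) _; rewrite normrN /M.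
    by have := normr_ge0 (ln (2 * a)); lra.
  apply: le_lt_trans hi _; apply: le_lt_trans (ler_norm _) _; rewrite /M.
  by have := normr_ge0 (ln (a / 2)); lra.
rewrite ltr0_norm// -ltr_pdivrMl// mulrC.
by rewrite ltrNr.
Unshelve. all: by end_near. Qed.

End LogAsymptotics.

(** * Order of vanishing and the resulting asymptotics *)

Section ShortTime.
Variables (R : realType) (H : hilbertType R) (L : operator H) (E : pvm H).
Hypotheses (L_ge0 : nonnegative_operator L) (E_L : is_spectral_measure E L).
Variables (f g : H).
Hypotheses (f_smooth : forall n, domain (oppow E n) f)
  (g_smooth : forall n, domain (oppow E n) g).

(** Lets the calculus vector move to the first slot, where its defining property determines it; only
    moduli are compared. *)
Lemma normc_innerC (x y : H) :
  Normc.normc (inner x y) = Normc.normc (inner y x).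
Proof. by apply: complexI; rewrite (innerC x y); exact: normcJ. Qed.

Lemma dL_fin : (dL E f g < +oo)%E -> exists d : nat,
  [/\ inner (oppow E d g) f != 0,
      forall k, (k < d)%N -> inner (oppow E k g) f = 0 &
      dL E f g = (d%:R)%:E].
Proof.
move=> dfin.
have in0 n : (inner f (oppow E n g) != 0) = (inner (oppow E n g) f != 0).
  by rewrite innerC conjC_eq0.
have exn : exists n, inner f (oppow E n g) != 0.
  apply: contrapT => /forallNP none; move: dfin; rewrite /dL.
  rewrite (_ : [set n | _] = set0) ?image_set0 ?ereal_inf0 ?ltxx//.
  by apply/seteqP; split => n //= /none.
have [d dne dmin] := ex_minnP exn.
exists d; split; first by rewrite -in0.
  move=> k kd; apply/eqP; rewrite -[_ == _]negbK -in0; apply/negP => /dmin.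
  by rewrite leqNgt kd.
apply/eqP; rewrite eq_le; apply/andP; split.
  by apply: ereal_inf_lbound; exists d.
by apply: le_ereal_inf_tmp => _ [n /= /dmin dn <-]; rewrite lee_fin ler_nat.
Qed.

Lemma dL_infty : dL E f g = +oo%E -> forall n, inner (oppow E n g) f = 0.
Proof.
move=> dinf n; apply/eqP; rewrite -conjC_eq0 -innerC; apply/negPn/negP => ne.
have : (dL E f g <= (n%:R)%:E)%E by apply: ereal_inf_lbound; exists n.
by rewrite dinf leye_eq.
Qed.

Lemma log_asymptotics w psi : exponential w psi -> (dL E f g < +oo)%E ->
  (lne (Normc.normc (inner f (calculus E (fun s => psi (t * s)) g)))%:E /
     lne t%:E)%E @[t --> 0^'+] --> dL E f g.
Proof.
move=> ewp /dL_fin[d [bd bk ->]]; have [w1 _ _ _ _] := ewp.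
(* Order [d + 1] includes the term of index [d], the only nonzero one in the sum, and leaves an
   error one power of [t] smaller. Since [|w| = 1], that term has modulus [a t^d] with the [a]
   below. *)
have [C [C0 CP]] := spectral_taylor d.+1 L_ge0 E_L ewp g_smooth f_smooth.
pose a := Normc.normc (inner (oppow E d g) f) / d`!%:R.
have a0 : 0 < a.
  rewrite divr_gt0 ?ltr0n ?fact_gt0// lt_neqAle eq_sym.
  apply/andP; split; last by case: (inner _ _) => ? ?; exact: sqrtr_ge0.
  by apply: contra bd => /eqP /Normc.eq0_normc ->.
apply: (ln_ratio_cvg a0 C0) => t t0; rewrite normc_innerC.
have := CP t t0; apply: le_trans.
rewrite big_ord_recr/= big1 ?add0r; last first.
  by move=> k _; rewrite bk ?mulr0.
set u := inner _ _; set v := _ * inner _ _.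
have -> : a * t ^+ d = Normc.normc v.
  rewrite /v !Normc.normcM normcXn// mul1r Normc.normcV.
  rewrite normcMn Normc.normc1.
  have -> : Normc.normc (t ^+ d)%:C = t ^+ d.
    by rewrite /= expr0n addr0 sqrtr_sqr ger0_norm ?exprn_ge0.
  by rewrite /a; ring.
(* Both halves of the reverse triangle inequality. *)
have uv := le_normcD (u - v) v; have vu := le_normcD (v - u) u.
rewrite subrK in uv; rewrite subrK -[Normc.normc (v - u)]normcN opprB in vu.
by rewrite ler_norml; apply/andP; split; lra.
Qed.

Lemma fast_decay w psi n : exponential w psi -> dL E f g = +oo%E ->
  exists C : R, 0 < C /\ forall t : R, 0 <= t ->
    Normc.normc (inner f (calculus E (fun s => psi (t * s)) g)) <= C * t ^+ n.
Proof.
move=> ewp /dL_infty b0.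
have [C [C0 CP]] := spectral_taylor n L_ge0 E_L ewp g_smooth f_smooth.
exists C; split => // t t0; rewrite normc_innerC.
have := CP t t0; rewrite big1 ?subr0// => k _.
by rewrite b0 mulr0.
Qed.

End ShortTime.

(** * Short-time behaviour of the heat semigroup and the unitary group *)

Theorem corollary1p4 (R : realType) (H : hilbertType R) (L : operator H)
    (selfadjoint_L : selfadjoint L) (L_ge0 : nonnegative_operator L)
    (E : pvm H) (E_L : is_spectral_measure E L) (f g : H)
    (f_smooth : forall n, domain (oppow E n) f)
    (g_smooth : forall n, domain (oppow E n) g) :
  ((dL E f g < +oo)%E ->
     ((lne (Normc.normc (inner f (heat E t g)))%:E / lne t%:E)%E
        @[t --> 0^'+] --> dL E f g) /\
     ((lne (Normc.normc (inner f (unitary_group E t g)))%:E / lne t%:E)%E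
        @[t --> 0^'+] --> dL E f g)) /\
  (dL E f g = +oo%E ->
     forall n : nat, exists C : R, 0 < C /\ forall t : R, 0 <= t ->
       Normc.normc (inner f (heat E t g)) <= C * t ^+ n.+1 /\
       Normc.normc (inner f (unitary_group E t g)) <= C * t ^+ n.+1).
Proof.
have heat_exp := exponential_heat R; have unit_exp := exponential_unitary R.
split=> [dfin | dinf n].
  by split; [exact: (log_asymptotics L_ge0 E_L f_smooth g_smooth heat_exp)
            |exact: (log_asymptotics L_ge0 E_L f_smooth g_smooth unit_exp)].
have [C1 [C1_gt0 C1P]] :=
  fast_decay L_ge0 E_L f_smooth g_smooth n.+1 heat_exp dinf.
have [C2 [C2_gt0 C2P]] :=
  fast_decay L_ge0 E_L f_smooth g_smooth n.+1 unit_exp dinf.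
(* One constant has to serve both exponentials; the sum dominates each. *)
exists (C1 + C2); split=> [|t t0]; first exact: addr_gt0.
split; [apply: le_trans (C1P t t0) _|apply: le_trans (C2P t t0) _];
  by rewrite ler_wpM2r ?exprn_ge0// ?lerDl ?lerDr ltW.
Qed.
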